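(* Let $A,B\subseteq S\subseteq V$ with $A\cap B=\emptyset$. Then the following statements are equivalent: (a) $Y_A$ and $Y_B$ are contemporaneously uncorrelated with respect to $Y_S$, i.e. $\mathcal{L}_{Y_A}(t,t+1)\perp\mathcal{L}_{Y_B}(t,t+1)\mid\mathcal{L}_{Y_S}(t)$ for all $t\in\mathbb{R}$. (b) $\mathcal{L}_{Y_A}(t+1)\perp\mathcal{L}_{Y_B}(t+1)\mid\mathcal{L}_{Y_S}(t)$ for all $t\in\mathbb{R}$. (c) $\ell_{Y_A}(t,t+1)\perp\ell_{Y_B}(t,t+1)\mid\mathcal{L}_{Y_S}(t)$ for all $t\in\mathbb{R}$. (d) $\ell_{Y_a}(s,s)\perp\ell_{Y_b}(s',s')\mid\mathcal{L}_{Y_S}(t)$ for all $a\in A$, $b\in B$, $s,s'\in[t,t+1]$, $t\in\mathbb{R}$.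
   Context: $V=\{1,\ldots,k\}$ and $Y_V=(Y_V(t))_{t\in\mathbb{R}}$ is a $k$-dimensional weakly stationary stochastic process with expectation zero that is continuous in mean square, with components $Y_v=(Y_v(t))_{t\in\mathbb R}$, $v\in V$, and subprocesses $Y_A=(Y_a)_{a\in A}$ for $A\subseteq V$. $L^2=L^2(\Omega,\mathcal F,\mathbb P)$ is the Hilbert space of square-integrable complex-valued random variables with $\langle X,Y\rangle=\mathbb{E}[X\overline{Y}]$ (a.s. equal variables identified). $P_{\mathcal L}$ is the orthogonal projection onto a closed linear subspace $\mathcal L$. For $A\subseteq V$ and $-\infty\le s\le t\le\infty$, $\ell_{Y_A}(s,t)$ is the (not necessarily closed) complex linear span of $\{Y_a(u):a\in A,\ u\in[s,t]\cap\mathbb{R}\}$, $\mathcal{L}_{Y_A}(s,t)$ is its closure in $L^2$, and $\mathcal{L}_{Y_A}(t)=\mathcal{L}_{Y_A}(-\infty,t)$ (equal to $\{0\}$ if $A=\emptyset$). For linear subspaces $\mathcal{L}_1,\mathcal{L}_2$ and a closed subspace $\mathcal{L}_3$ of $L^2$, $\mathcal{L}_1\perp\mathcal{L}_2\mid\mathcal{L}_3$ (conditional orthogonality) means $\mathbb{E}[(X-P_{\mathcal{L}_3}X)\overline{(Y-P_{\mathcal{L}_3}Y)}]=0$ for all $X\in\mathcal{L}_1$, $Y\in\mathcal{L}_2$. *)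

(* Defs.v *)
From HB Require Import structures.
From mathcomp Require Import all_boot all_order all_algebra complex.
From mathcomp Require Import all_classical all_reals all_analysis.

Set Implicit Arguments.
Unset Strict Implicit.
Unset Printing Implicit Defensive.

Import Order.TTheory GRing.Theory Num.Theory.
Import numFieldNormedType.Exports.

Local Open Scope classical_set_scope.
Local Open Scope ring_scope.

Section ComplexL2.
Context {R : realType} {d : measure_display} {T : measurableType d}.
Variable P : probability T R.
Implicit Types (X Z : T -> R[i]) (G L : set (T -> R[i])).

(* Random variables are functions; the identification of almost surely equal
   ones is expressed by making every subspace below saturated for a.s.
   equality. *)
Definition L2 : set (T -> R[i]) :=
  [set X : T -> R[i] | (@complex.Re R \o X) \in Lfun P 2%:E /\
           (@complex.Im R \o X) \in Lfun P 2%:E].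

Definition cexpectation X : R[i] :=
  (fine 'E_P[@complex.Re R \o X] +i* fine 'E_P[@complex.Im R \o X])%C.

Definition inner X Z : R[i] := cexpectation (fun w : T => X w * conjc (Z w)).

(* [inner X X] is real for [X] in [L2]. *)
Definition norm2 X : R := Num.sqrt (@complex.Re R (inner X X)).

Definition lin_span G : set (T -> R[i]) :=
  [set X : T -> R[i] | L2 X /\
    exists n (c : 'I_n -> R[i]) (Z : 'I_n -> T -> R[i]),
      (forall j, G (Z j)) /\ {ae P, forall w, X w = \sum_(j < n) c j * Z j w}].

Definition closure2 G : set (T -> R[i]) :=
  [set X : T -> R[i] | L2 X /\
    forall e : R, 0 < e -> exists2 Z, G Z & norm2 (X \- Z) < e].

Definition is_proj L X : set (T -> R[i]) :=
  [set X' : T -> R[i] | L X' /\ forall Z, L Z -> inner (X \- X') Z = 0].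

(* For [L] a closed subspace of [L2] and [X] in [L2], [is_proj L X] is a single
   class of a.s. equal variables, from which a representative is chosen; the
   default value 0 is irrelevant. *)
Definition proj L X : T -> R[i] := xget (cst 0) (is_proj L X).

Definition cond_orth (L1 L2 L3 : set (T -> R[i])) : Prop :=
  forall X Z, L1 X -> L2 Z -> inner (X \- proj L3 X) (Z \- proj L3 Z) = 0.

End ComplexL2.

Section Process.
Context {R : realType} {d : measure_display} {T : measurableType d}.
Variables (P : probability T R) (k : nat) (Y : 'I_k -> R -> T -> R[i]).

Definition centered_at (v : 'I_k) (t : R) : T -> R[i] :=
  fun w => Y v t w - cexpectation P (Y v t).

Definition weakly_stationary : Prop :=
  [/\ forall v t, L2 P (Y v t),
      forall v s t, cexpectation P (Y v s) = cexpectation P (Y v t) &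
      forall u v s t h,
        inner P (centered_at u (s + h)) (centered_at v (t + h)) =
        inner P (centered_at u s) (centered_at v t)].

Definition zero_mean : Prop := forall v t, cexpectation P (Y v t) = 0.

Definition mean_square_continuous : Prop :=
  forall v (t : R), norm2 P (Y v s \- Y v t) @[s --> t] --> (0 : R).

Definition ell (A : {set 'I_k}) (s t : \bar R) : set (T -> R[i]) :=
  lin_span P [set X : T -> R[i] | exists a u,
    [/\ a \in A, (s <= u%:E <= t)%E & X = Y a u]].

Definition cell (A : {set 'I_k}) (s t : \bar R) : set (T -> R[i]) :=
  closure2 P (ell A s t).

Definition past (A : {set 'I_k}) (t : R) : set (T -> R[i]) :=
  cell A -oo%E t%:E.

Definition contemporaneously_uncorrelated (A B S : {set 'I_k}) : Prop :=
  forall t : R, cond_orth P (cell A t%:E (t + 1)%:E) (cell B t%:E (t + 1)%:E)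
                            (past S t).

End Process.

(* Main.v *)
Require Import Defs.
From mathcomp Require Import all_boot all_order all_algebra complex.
From mathcomp Require Import all_classical all_reals all_analysis.
From mathcomp Require Import measurable_realfun ring lra.

(** Write r X = X - P_L X for the residual of X with respect to the closed
    subspace L spanned by the past of Y_S.

    The residual of Z is orthogonal to L, which contains P_L X, so
    <r X, r Z> = <X, r Z> ([inner_residuals]). For fixed Z the right-hand side
    is linear and continuous in X, hence vanishes on a closed linear span as
    soon as it vanishes on the generators; exchanging the roles of X and Z does
    the same for Z. Conditional orthogonality given L thus passes from two
    families of variables to their closed linear spans
    ([cond_orth_closure_span]), and all four statements reduce to statements
    on pairs of observations Y_a(s), Y_b(s'). Two sets of pairs remain to be
    compared: those with times in [t, t+1], and those with times at most t+1. If one of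
    the times is at most t, the observation lies in L because A and B are
    contained in S, and the residual of its partner is orthogonal to L
    ([cond_orth_mem_l], [cond_orth_mem_r]). So both families of conditions say
    the same. The cycle proved is (a) -> (b) -> (c) -> (d) -> (a), where (b) ->
    (c) -> (d) are inclusions of subspaces.

    All this presupposes that P_L X exists. The classical argument is carried
    out in full: a minimising sequence in the span is Cauchy by the
    parallelogram law, it converges because square-integrable functions are
    complete, and its limit is the projection ([projection_exists]).
    Completeness is proved for sequences whose increments decay geometrically:
    if the sum G of 4^n (f_(n+1) - f_n)^2 has finite mean, then G is finite
    almost surely, f_n converges there to some g, and
    (f_n - g)^2 <= 4 G / 4^n. This single domination gives both the
    square-integrability of g and the convergence in mean square
    ([Lfun2_fast_cauchy]). *)

Set Implicit Arguments.
Unset Strict Implicit.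
Unset Printing Implicit Defensive.

Import Order.TTheory GRing.Theory Num.Theory.
Import numFieldNormedType.Exports.

Local Open Scope classical_set_scope.
Local Open Scope ring_scope.

(** * Elementary facts on real numbers *)

(** The quadratic in t is least at t = 1/s. The conclusion is Cauchy-Schwarz when
    e is a squared norm, and near-orthogonality when e is the defect of a
    near-minimiser. *)
Lemma quadratic_ge0_le (R : realType) (e q s : R) : 0 <= s ->
  (forall t : R, 0 <= e - 2 * t * q + t ^+ 2 * (q * s)) -> 0 <= q -> q <= e * s.
Proof.
move=> s0 H q0; have [s_eq0|s_neq0] := eqVneq s 0.
  (* For s = 0 the bound is linear in t, and this t makes it equal to -1. *)
  rewrite s_eq0 mulr0 leNgt; apply/negP => qp.
  have := H ((e + 1) / (2 * q)); rewrite s_eq0 !mulr0 addr0.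
  rewrite (_ : _ - _ = -1); first lra.
  by field; rewrite gt_eqF.
have := H s^-1; rewrite (_ : _ + _ = e - q / s); last by field.
by rewrite subr_ge0 ler_pdivrMr // lt0r s_neq0.
Qed.

Lemma le0_of_small (R : realType) (x s : R) : 0 <= s ->
  (forall e, 0 < e -> x <= e * s) -> x <= 0.
Proof.
move=> s0 H; rewrite leNgt; apply/negP => x0.
have /H : 0 < x / (2 * (s + 1)) by rewrite divr_gt0// mulr_gt0// ltr_wpDl.
by rewrite mulrAC ler_pdivlMr ?mulr_gt0 ?ltr_wpDl//; nra.
Qed.

Lemma geometric4_small (R : realType) (C e : R) : 0 <= C -> 0 < e ->
  exists n, C / 4 ^+ n < e.
Proof.
move=> C0 e0; have : C * 4^-1 ^+ n @[n --> \oo] --> (0 : R).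
  apply: cvg_geometric; rewrite ger0_norm; lra.
move/cvgrPdist_lt => /(_ _ e0) [N _ /(_ N (leqnn N))] /=.
rewrite sub0r normrN exprVn => H; exists N.
by apply: le_lt_trans H; rewrite ler_norm.
Qed.

(** With s the square root of M, the increments are at most s / 2^n, so the
    tails are at most 2 s / 2^n; the bound on the distance to the limit is
    explicit because it serves as a domination once M depends on a random
    point. *)
Lemma fast_cauchy_cvg (R : realType) (u : nat -> R) (M : R) :
  (forall n, 4 ^+ n * (u n.+1 - u n) ^+ 2 <= M) ->
  cvgn u /\ forall n, (u n - limn u) ^+ 2 <= 4 * M / 4 ^+ n.
Proof.
move=> uM; have M0 : 0 <= M.
  by apply: le_trans (uM 0%N); rewrite mulr_ge0// ?sqr_ge0// exprn_ge0.
pose s := Num.sqrt M.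
have s0 : 0 <= s by rewrite sqrtr_ge0.
have h0 n : 0 <= (1 / 2 : R) ^+ n by rewrite exprn_ge0// divr_ge0.
have sM : s ^+ 2 = M by rewrite sqr_sqrtr.
have step n : `|u n.+1 - u n| <= s * (1 / 2) ^+ n.
  rewrite -ler_sqr ?nnegrE ?mulr_ge0//.
  rewrite real_normK ?num_real// exprMn sM -exprM mulnC exprM.
  rewrite (_ : (1 / 2) ^+ 2 = 4^-1 :> R); last by field.
  by rewrite exprVn ler_pdivlMr ?exprn_gt0// mulrC.
have dist n k : `|u (n + k)%N - u n| <= 2 * s * (1 / 2) ^+ n * (1 - (1 / 2) ^+ k).
  elim: k => [|k IH]; first by rewrite addn0 expr0 !subrr normr0 mulr0.
  rewrite addnS (_ : u _ - u n = (u (n + k).+1 - u (n + k)%N) +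
    (u (n + k)%N - u n)); last by ring.
  apply: (le_trans (ler_normD _ _)); apply: (le_trans (lerD (step _) IH)).
  by rewrite exprD exprS le_eqVlt; apply/orP; left; apply/eqP; field.
have dist2 n m : (n <= m)%N -> `|u m - u n| <= 2 * s * (1 / 2) ^+ n.
  move=> nm; rewrite -(subnKC nm); apply: (le_trans (dist _ _)).
  by rewrite ler_piMr ?mulr_ge0// lerBlDr lerDl.
have cu : cvgn u.
  apply: cauchy_cvg; apply: cauchy_exP => e e0 /=.
  have : 2 * s * (1 / 2) ^+ n @[n --> \oo] --> (0 : R).
    apply: cvg_geometric; rewrite ger0_norm; lra.
  move/cvgrPdist_lt => /(_ _ e0) [N _ /(_ N (leqnn N))] /= sN.
  exists (u N); exists N => // m /= Nm; rewrite /ball/= distrC.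
  apply: (le_lt_trans (dist2 _ _ Nm)).
  by move: sN; rewrite sub0r normrN; apply: le_lt_trans; rewrite ler_norm.
split=> // n.
have cB : u n - u m @[m --> \oo] --> u n - limn u.
  by apply: cvgB => //; exact: cvg_cst.
have cX : (u n - u m) ^+ 2 @[m --> \oo] --> (u n - limn u) ^+ 2.
  exact: (cvgM cB cB).
rewrite -(cvg_lim _ cX)//; apply: limr_le; first by apply/cvg_ex; eexists; exact: cX.
exists n => // m /= nm; have := dist2 _ _ nm.
rewrite distrC -ler_sqr ?nnegrE ?mulr_ge0//.
rewrite real_normK ?num_real// => /le_trans; apply.
rewrite 2!exprMn sM -exprM mulnC exprM.
rewrite (_ : (1 / 2) ^+ 2 = 4^-1 :> R); last by field.
by rewrite exprVn (_ : 2 ^+ 2 = 4 :> R)//; ring.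
Qed.

(** * Completeness of the real square-integrable functions *)

Section RealSquareIntegrable.
Context {R : realType} {d : measure_display} {T : measurableType d}.
Variable P : probability T R.
Implicit Types (f g : T -> R).

Definition mean f : R := fine 'E_P[f].

Lemma Lfun_lin (p : \bar R) (a : R) f g : (1 <= p)%E ->
  f \in Lfun P p -> g \in Lfun P p -> (fun w => a * f w + g w) \in Lfun P p.
Proof. by move=> p1; exact: (Lfun_submod_closed P p1).2. Qed.

Lemma mean_lin (a : R) f g : f \in Lfun P 1 -> g \in Lfun P 1 ->
  mean (fun w => a * f w + g w) = a * mean f + mean g.
Proof.
move=> f1 g1; have af1 : (a \o* f) \in Lfun P 1.
  rewrite (_ : a \o* f = fun w => a * f w + 0); last first.
    by apply/funext => w /=; rewrite addr0 mulrC.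
  by apply: Lfun_lin => //; exact: Lfun_cst.
rewrite /mean (_ : (fun w => _) = (a \o* f) \+ g); last first.
  by apply/funext => w /=; rewrite mulrC.
rewrite expectationD// fineD ?expectation_fin_num//.
by rewrite expectationZl// fineM ?expectation_fin_num.
Qed.

Lemma eq_ae_mean f g : f \in Lfun P 1 -> g \in Lfun P 1 ->
  {ae P, forall w, f w = g w} -> mean f = mean g.
Proof.
move=> f1 g1 fg; rewrite /mean unlock; congr fine.
apply: ae_eq_integral => //.
- by move/Lfun1_integrable/integrableP: f1 => [].
- by move/Lfun1_integrable/integrableP: g1 => [].
- by move: fg; apply: filterS => w -> _.
Qed.

Lemma Lfun_measurable (p : \bar R) f : f \in Lfun P p -> measurable_fun setT f.
Proof. by rewrite inE => /andP[/[!inE]/=]. Qed.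

Lemma sqr_integrable_Lfun2 f : measurable_fun setT f ->
  (\int[P]_w (f w ^+ 2)%:E < +oo)%E -> f \in Lfun P 2%:E.
Proof.
move=> mf foo; rewrite inE; apply/andP; split; rewrite inE//= /finite_norm.
rewrite unlock poweR_lty//; apply: le_lt_trans foo; rewrite le_eqVlt.
apply/orP; left; apply/eqP/eq_integral => w _ /=.
by rewrite powR_mulrn// real_normK// num_real.
Qed.

Lemma sqr_Lfun1 f : f \in Lfun P 2%:E -> (fun w => f w ^+ 2) \in Lfun P 1.
Proof. by move=> f2; exact: (Lfun2_mul_Lfun1 f2 f2). Qed.

Lemma mean_integral f : f \in Lfun P 1 ->
  (\int[P]_w (f w)%:E)%E = (mean f)%:E.
Proof.
by move=> f1; rewrite /mean fineK ?expectation_fin_num// unlock.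
Qed.

(** Completeness of the square-integrable functions, with the rate that the
    domination by the sum of weighted squared increments provides. *)
Lemma Lfun2_fast_cauchy (f : nat -> T -> R) (C : R) :
  (forall n, f n \in Lfun P 2%:E) ->
  (forall n, 4 ^+ n * mean (fun w => (f n.+1 w - f n w) ^+ 2) <=
             C / (2 ^ (n + 1))%:R) ->
  exists2 g, g \in Lfun P 2%:E &
    forall n, mean (fun w => (f n w - g w) ^+ 2) <= 4 * C / 4 ^+ n.
Proof.
move=> f2 fC.
have LB h h' : h \in Lfun P 2%:E -> h' \in Lfun P 2%:E ->
    (fun w => h w - h' w) \in Lfun P 2%:E.
  move=> h2 h'2; rewrite (_ : (fun w => _) = fun w => -1 * h' w + h w).
    by apply: Lfun_lin => //; rewrite lee1n.
  by apply/funext => w; ring.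
pose D n w : \bar R := (4 ^+ n * (f n.+1 w - f n w) ^+ 2)%:E.
have D0 n w : (0 <= D n w)%E by rewrite lee_fin mulr_ge0 ?sqr_ge0// exprn_ge0.
have mD n : measurable_fun setT (D n).
  apply/measurable_EFinP; apply: measurable_funM => //.
  by apply: measurable_funX; apply: (Lfun_measurable (LB _ _ (f2 _) (f2 _))).
pose G w : \bar R := (\sum_(n <oo) D n w)%E.
have G0 w : (0 <= G w)%E by apply: nneseries_ge0.
have mG : measurable_fun setT G.
  by apply: ge0_emeasurable_sum => // k x _ _; exact: D0.
(* The mean of G is at most the sum of C / 2^(n+1), which is C. *)
have GC : (\int[P]_w G w <= C%:E)%E.
  rewrite integral_nneseries//.
  rewrite -[leRHS](_ : (\sum_(k <oo) (C / (2 ^ (k + 1))%:R)%:E)%E = _); last first.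
    have := @cvg_geometric_eseries_half R C 0; rewrite expr0 divr1.
    by move/cvg_lim => ->.
  apply: lee_nneseries => [n _ _|n _]; first exact: integral_ge0.
  rewrite /D; under eq_integral do rewrite EFinM.
  rewrite ge0_integralZl ?lee_fin ?exprn_ge0//.
    by rewrite mean_integral -?EFinM ?lee_fin//; apply: sqr_Lfun1; exact: LB.
  by apply/measurable_EFinP/measurable_funX/(Lfun_measurable (LB _ _ (f2 _) (f2 _))).
  by move=> w _; rewrite lee_fin sqr_ge0.
have Gfin : {ae P, forall w, G w \is a fin_num}.
  have iG : P.-integrable setT G.
    apply/integrableP; split=> //; under eq_integral do rewrite gee0_abs//.
    by rewrite (le_lt_trans GC)// ltry.
  by apply: filterS (integrable_ae measurableT iG) => w; exact.
(* The upper limit is measurable without any convergence; on the almost sure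
   event where G is finite it is the limit. *)
pose g w := fine (limn_esup (fun n => (f n w)%:E)).
have mg : measurable_fun setT g.
  apply: measurableT_comp => //; apply: measurable_fun_limn_esup => n.
  by apply/measurable_EFinP; exact: Lfun_measurable (f2 n).
(* The domination: on that event G w plays the part of M in
   [fast_cauchy_cvg]. *)
have fg n : {ae P, forall w, (((f n w - g w) ^+ 2)%:E <= (4 / 4 ^+ n)%:E * G w)%E}.
  apply: filterS Gfin => w Gw.
  have [n'|cf dist] := @fast_cauchy_cvg R (fun n => f n w) (fine (G w)).
    rewrite -lee_fin fineK//.
    have := @nneseries_lim_ge R (fun n => D n w) xpredT 0 n'.+1 (fun n _ _ => D0 n w).
    apply: le_trans; rewrite big_nat_recr//= leeDr//.
    by apply: sume_ge0 => i _; exact: D0.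
  have -> : g w = limn (fun n => f n w).
    rewrite /g is_cvg_limn_esupE//; last by apply/cvg_ex; eexists; apply: cvg_EFin; [exact: nearW|exact: cf].
    by rewrite EFin_lim.
  rewrite -(fineK Gw) -EFinM lee_fin; apply: le_trans (dist n) _.
  by rewrite mulrAC.
have ifg n : (\int[P]_w ((f n w - g w) ^+ 2)%:E <= (4 * C / 4 ^+ n)%:E)%E.
  apply: (@le_trans _ _ (\int[P]_w ((4 / 4 ^+ n)%:E * G w))%E).
    apply: ae_ge0_le_integral => //.
    - by move=> w _; rewrite lee_fin sqr_ge0.
    - apply/measurable_EFinP; apply: measurable_funX; apply: measurable_funB => //.
      exact: Lfun_measurable (f2 n).
    - by move=> w _; rewrite mule_ge0// lee_fin divr_ge0// exprn_ge0.
    - by apply: emeasurable_funM.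
    - by apply: filterS (fg n) => w.
  rewrite ge0_integralZl ?lee_fin ?divr_ge0 ?exprn_ge0//.
  rewrite mulrAC [in leRHS]EFinM; apply: lee_wpmul2l => //; exact: GC.
have fg2 n : (fun w => f n w - g w) \in Lfun P 2%:E.
  apply: sqr_integrable_Lfun2; last by rewrite (le_lt_trans (ifg n))// ltry.
  apply: measurable_funB => //; exact: Lfun_measurable (f2 n).
exists g.
  rewrite (_ : g = fun w => f 0%N w - (f 0%N w - g w)); first exact: LB.
  by apply/funext => w; rewrite subKr.
by move=> n; rewrite -lee_fin -mean_integral//; exact: sqr_Lfun1.
Qed.

End RealSquareIntegrable.

(** * The inner product of complex random variables *)

Section ComplexHilbert.
Context {R : realType} {d : measure_display} {T : measurableType d}.
Variable P : probability T R.
Implicit Types (f g : T -> R) (X Z U V W : T -> R[i]).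
Implicit Types (G H M : set (T -> R[i])).

Local Notation Re := (@complex.Re R).
Local Notation Im := (@complex.Im R).

(** The space [L2] is the case p = 2; the case p = 1 makes [cexpectation]
    linear. *)
Definition cLfun (p : \bar R) : set (T -> R[i]) :=
  [set X : T -> R[i] | (Re \o X) \in Lfun P p /\ (Im \o X) \in Lfun P p].

Lemma cLfun_lin (p : \bar R) (a : R[i]) X Z : (1 <= p)%E ->
  cLfun p X -> cLfun p Z -> cLfun p (fun w => a * X w + Z w).
Proof.
move=> p1 [rX iX] [rZ iZ]; case: a => r s; split.
  rewrite (_ : Re \o _ =
      fun w => r * (Re \o X) w + (- s * (Im \o X) w + (Re \o Z) w)).
    by do 2 apply: Lfun_lin => //.
  by apply/funext => w /=; case: (X w) (Z w) => ? ? [? ?] /=; ring.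
rewrite (_ : Im \o _ =
    fun w => r * (Im \o X) w + (s * (Re \o X) w + (Im \o Z) w)).
  by do 2 apply: Lfun_lin => //.
by apply/funext => w /=; case: (X w) (Z w) => ? ? [? ?] /=; ring.
Qed.

Lemma cexpectation_lin (a : R[i]) X Z : cLfun 1 X -> cLfun 1 Z ->
  cexpectation P (fun w => a * X w + Z w) =
  a * cexpectation P X + cexpectation P Z.
Proof.
move=> [rX iX] [rZ iZ]; case: a => r s; rewrite /cexpectation.
rewrite (_ : Re \o _ =
    fun w => r * (Re \o X) w + (- s * (Im \o X) w + (Re \o Z) w)); last first.
  by apply/funext => w /=; case: (X w) (Z w) => ? ? [? ?] /=; ring.
rewrite (_ : Im \o (fun w => _ + _) =
    fun w => r * (Im \o X) w + (s * (Re \o X) w + (Im \o Z) w)); last first.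
  by apply/funext => w /=; case: (X w) (Z w) => ? ? [? ?] /=; ring.
rewrite -!/(mean P _) !mean_lin//; try exact: Lfun_lin.
by apply/eqP; rewrite eq_complex /=; apply/andP; split; apply/eqP; ring.
Qed.

Lemma eq_ae_cexpectation X Z : cLfun 1 X -> cLfun 1 Z ->
  {ae P, forall w, X w = Z w} -> cexpectation P X = cexpectation P Z.
Proof.
move=> [rX iX] [rZ iZ] XZ; rewrite /cexpectation -!/(mean P _).
by congr (_ +i* _)%C; apply: eq_ae_mean => //; move: XZ;
  apply: filterS => w /= ->.
Qed.

Lemma cexpectation_conj X : cLfun 1 X ->
  cexpectation P (fun w => conjc (X w)) = conjc (cexpectation P X).
Proof.
move=> [rX iX]; rewrite /cexpectation /=; congr (_ +i* _)%C.
  by congr (fine ('E_P[_])); apply/funext => w /=; case: (X w).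
rewrite -!/(mean P _) (_ : Im \o _ = fun w => -1 * (Im \o X) w + 0).
  rewrite mean_lin ?Lfun_cst// /mean expectation_cst /=; ring.
by apply/funext => w /=; case: (X w) => ? ? /=; ring.
Qed.

Lemma L2_mul X Z : L2 P X -> L2 P Z -> cLfun 1 (fun w => X w * conjc (Z w)).
Proof.
move=> [rX iX] [rZ iZ]; split.
  rewrite (_ : Re \o _ =
    fun w => 1 * ((Re \o X) \* (Re \o Z)) w + ((Im \o X) \* (Im \o Z)) w).
    by apply: Lfun_lin => //; exact: Lfun2_mul_Lfun1.
  by apply/funext => w /=; case: (X w) (Z w) => ? ? [? ?] /=; ring.
rewrite (_ : Im \o _ =
  fun w => -1 * ((Re \o X) \* (Im \o Z)) w + ((Im \o X) \* (Re \o Z)) w).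
  by apply: Lfun_lin => //; exact: Lfun2_mul_Lfun1.
by apply/funext => w /=; case: (X w) (Z w) => ? ? [? ?] /=; ring.
Qed.

Lemma L2_lin (a : R[i]) X Z : L2 P X -> L2 P Z ->
  L2 P (fun w => a * X w + Z w).
Proof. by apply: cLfun_lin; rewrite lee1n. Qed.

Lemma L2B X Z : L2 P X -> L2 P Z -> L2 P (X \- Z).
Proof.
move=> X2 Z2; rewrite (_ : X \- Z = fun w => -1 * Z w + X w).
  exact: L2_lin.
by apply/funext => w /=; rewrite mulN1r addrC.
Qed.

Lemma L2_0 : L2 P (fun=> 0).
Proof. by split; exact: Lfun_cst. Qed.

Lemma inner_linl (a : R[i]) X X' Z : L2 P X -> L2 P X' -> L2 P Z ->
  inner P (fun w => a * X w + X' w) Z = a * inner P X Z + inner P X' Z.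
Proof.
move=> X2 X'2 Z2; rewrite /inner -cexpectation_lin; try exact: L2_mul.
by congr cexpectation; apply/funext => w; rewrite mulrDl mulrA.
Qed.

Lemma innerC X Z : L2 P X -> L2 P Z -> inner P Z X = conjc (inner P X Z).
Proof.
move=> X2 Z2; rewrite /inner -cexpectation_conj; last exact: L2_mul.
by congr cexpectation; apply/funext => w; rewrite rmorphM/= conjcK mulrC.
Qed.

Lemma inner_linr (a : R[i]) X X' Z : L2 P X -> L2 P X' -> L2 P Z ->
  inner P Z (fun w => a * X w + X' w) =
  conjc a * inner P Z X + inner P Z X'.
Proof.
move=> X2 X'2 Z2; rewrite innerC//; last exact: L2_lin.
by rewrite inner_linl// (innerC X2 Z2) (innerC X'2 Z2) rmorphD rmorphM.
Qed.

Lemma innerBl X X' Z : L2 P X -> L2 P X' -> L2 P Z ->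
  inner P (X \- X') Z = inner P X Z - inner P X' Z.
Proof.
move=> X2 X'2 Z2; rewrite (_ : X \- X' = fun w => -1 * X' w + X w).
  by rewrite inner_linl// mulN1r addrC.
by apply/funext => w /=; rewrite mulN1r addrC.
Qed.

Lemma inner0l Z : L2 P Z -> inner P (fun=> 0) Z = 0.
Proof.
move=> Z2; rewrite -[RHS](subrr (inner P (fun=> 0) Z)) -innerBl//.
  by congr (inner P); apply/funext => w /=; rewrite subrr.
all: exact: L2_0.
Qed.

Lemma inner_suml n (c : 'I_n -> R[i]) (X : 'I_n -> T -> R[i]) Z :
  (forall j, L2 P (X j)) -> L2 P Z ->
  L2 P (fun w => \sum_(j < n) c j * X j w) /\
  inner P (fun w => \sum_(j < n) c j * X j w) Z =
  \sum_(j < n) c j * inner P (X j) Z.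
Proof.
elim: n c X => [|n IH] c X X2 Z2.
  rewrite (_ : (fun w => _) = fun=> 0); last by apply/funext => w; rewrite big_ord0.
  by rewrite big_ord0 inner0l//; split => //; exact: L2_0.
have [S2 SE] := IH (c \o lift ord0) (X \o lift ord0) (fun j => X2 _) Z2.
rewrite (_ : (fun w => _) = fun w => c ord0 * X ord0 w +
    \sum_(j < n) (c \o lift ord0) j * (X \o lift ord0) j w); last first.
  by apply/funext => w; rewrite big_ord_recl.
split; first exact: L2_lin.
by rewrite inner_linl// SE big_ord_recl.
Qed.

Lemma eq_ae_innerl X X' Z : L2 P X -> L2 P X' -> L2 P Z ->
  {ae P, forall w, X w = X' w} -> inner P X Z = inner P X' Z.
Proof.
move=> X2 X'2 Z2 XX'; apply: eq_ae_cexpectation; try exact: L2_mul.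
by move: XX'; apply: filterS => w ->.
Qed.

Definition sqnorm X : R := Re (inner P X X).

Lemma sqnormE X : L2 P X -> sqnorm X =
  mean P (fun w => (Re \o X) w ^+ 2) + mean P (fun w => (Im \o X) w ^+ 2).
Proof.
move=> [rX iX]; rewrite /sqnorm /inner /cexpectation /= -/(mean P _).
rewrite -[X in X + _]mul1r -mean_lin; last 2 first.
  exact: (Lfun2_mul_Lfun1 rX rX).
  exact: (Lfun2_mul_Lfun1 iX iX).
by congr mean; apply/funext => w /=; case: (X w) => a b /=; ring.
Qed.

Lemma mean_sqr_ge0 f : 0 <= mean P (fun w => f w ^+ 2).
Proof. by rewrite fine_ge0// expectation_ge0// => w; exact: sqr_ge0. Qed.

Lemma sqnorm_ge0 X : L2 P X -> 0 <= sqnorm X.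
Proof. by move=> X2; rewrite sqnormE// addr_ge0// mean_sqr_ge0. Qed.

Lemma innerXX X : L2 P X -> inner P X X = (sqnorm X)%:C%C.
Proof.
move=> X2; have := innerC X2 X2; rewrite /sqnorm; case: (inner P X X) => a b.
by move=> -[] bE; congr (_ +i* _)%C; lra.
Qed.

Lemma norm2_lt X (e : R) : L2 P X -> 0 < e ->
  (norm2 P X < e) = (sqnorm X < e ^+ 2).
Proof.
move=> X2 e0; rewrite /norm2 -/(sqnorm X).
by rewrite -{1}(ger0_norm (ltW e0)) -sqrtr_sqr ltr_sqrt// exprn_gt0.
Qed.

Definition sqmod (z : R[i]) : R := Re z ^+ 2 + Im z ^+ 2.

Lemma sqmod_ge0 z : 0 <= sqmod z.
Proof. by rewrite addr_ge0 ?sqr_ge0. Qed.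

Lemma sqmod_eq0 z : sqmod z <= 0 -> z = 0.
Proof.
case: z => a b; rewrite /sqmod /= => ab.
by apply/eqP; rewrite eq_complex/=; apply/andP; split; apply/eqP; nra.
Qed.

Lemma sqmodD (z z' : R[i]) : sqmod (z + z') <= 2 * sqmod z + 2 * sqmod z'.
Proof.
case: z z' => a b [a' b']; rewrite /sqmod /=.
have := sqr_ge0 (a - a'); have := sqr_ge0 (b - b'); nra.
Qed.

Lemma sqnorm_sub U V (c : R[i]) : L2 P U -> L2 P V ->
  sqnorm (fun w => U w - c * V w) =
  sqnorm U - 2 * Re (conjc c * inner P U V) + sqmod c * sqnorm V.
Proof.
move=> U2 V2; rewrite /sqnorm.
rewrite (_ : (fun w => _) = fun w => - c * V w + U w); last first.
  by apply/funext => w; ring.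
rewrite inner_linl//; last exact: L2_lin.
rewrite !inner_linr// (innerC U2 V2) !innerXX// /sqmod.
by case: c (inner P U V) => a b [x y] /=; ring.
Qed.

(** The variational argument behind the orthogonality of minimisers, in a
    quantitative form that applies to near-minimisers. *)
Lemma near_orthogonal U V (e : R) : L2 P U -> L2 P V ->
  (forall c : R[i], sqnorm U - e <= sqnorm (fun w => U w - c * V w)) ->
  sqmod (inner P U V) <= e * sqnorm V.
Proof.
move=> U2 V2 H; apply: quadratic_ge0_le => [|t|]; last exact: sqmod_ge0.
  exact: sqnorm_ge0.
(* The best multiples of V to subtract are real multiples of <U, V> V. *)
have := H (t%:C%C * inner P U V); rewrite sqnorm_sub//.
rewrite lerBlDr -subr_ge0; congr (0 <= _).
by rewrite /sqmod; case: (inner P U V) => x y /=; ring.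
Qed.

(** A squared norm can never drop by more than its value: [near_orthogonal]
    with the largest possible defect. *)
Lemma cauchy_schwarz U V : L2 P U -> L2 P V ->
  sqmod (inner P U V) <= sqnorm U * sqnorm V.
Proof.
move=> U2 V2; apply: near_orthogonal => // c; rewrite subrr.
have -> : (fun w => U w - c * V w) = fun w => - c * V w + U w.
  by apply/funext => w; ring.
by apply: sqnorm_ge0; exact: L2_lin.
Qed.

(** In the form used for minimising sequences: the midpoint of U and V is
    isolated, since it is what a lower bound applies to. *)
Lemma parallelogram U V : L2 P U -> L2 P V ->
  sqnorm (fun w => U w - V w) =
  2 * sqnorm U + 2 * sqnorm V - 4 * sqnorm (fun w => 2^-1 * U w + 2^-1 * V w).
Proof.
move=> U2 V2.
(* All three norms are brought to the shape expanded by [sqnorm_sub]. *)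
have -> : (fun w => 2^-1 * U w + 2^-1 * V w) =
          (fun w => (2^-1 * U w + 0) - (- 2^-1) * V w).
  by apply/funext => w; ring.
have -> : (fun w => U w - V w) = (fun w => U w - 1 * V w).
  by apply/funext => w; ring.
rewrite !sqnorm_sub//; last by apply: L2_lin => //; exact: L2_0.
rewrite inner_linl//; last exact: L2_0.
have -> : (fun w => 2^-1 * U w + 0) = (fun w => (0 : R[i]) - (- 2^-1) * U w).
  by apply/funext => w; ring.
rewrite sqnorm_sub//; last exact: L2_0.
rewrite !inner0l//.
have -> : sqnorm (fun=> 0) = 0 by rewrite /sqnorm inner0l//; exact: L2_0.
have -> : (2^-1 : R[i]) = (2^-1)%:C%C by rewrite rmorphV/= ?unitfE// rmorph_nat.
by rewrite /sqmod; case: (inner P U V) => x y /=; field.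
Qed.

(** The real and imaginary parts inherit the bound on the increments, and the
    two real limits are assembled. *)
Lemma L2_fast_cauchy (X : nat -> T -> R[i]) (C : R) :
  (forall n, L2 P (X n)) ->
  (forall n, 4 ^+ n * sqnorm (X n.+1 \- X n) <= C / (2 ^ (n + 1))%:R) ->
  exists2 Z, L2 P Z & forall n, sqnorm (X n \- Z) <= 8 * C / 4 ^+ n.
Proof.
move=> X2 XC.
have ReB (U V : T -> R[i]) : (fun w => (Re \o (U \- V)) w ^+ 2) =
    fun w => ((Re \o U) w - (Re \o V) w) ^+ 2.
  by apply/funext => w /=; case: (U w) (V w) => ? ? [].
have ImB (U V : T -> R[i]) : (fun w => (Im \o (U \- V)) w ^+ 2) =
    fun w => ((Im \o U) w - (Im \o V) w) ^+ 2.
  by apply/funext => w /=; case: (U w) (V w) => ? ? [].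
have pos n : 0 <= (4 : R) ^+ n by rewrite exprn_ge0.
have [|g g2 gC] := @Lfun2_fast_cauchy _ _ _ P (fun n => Re \o X n) C (fun n => (X2 n).1).
  move=> n; apply: le_trans (XC n); rewrite ler_wpM2l//.
  rewrite sqnormE; last exact: L2B.
  by rewrite ReB lerDl mean_sqr_ge0.
have [|h h2 hC] := @Lfun2_fast_cauchy _ _ _ P (fun n => Im \o X n) C (fun n => (X2 n).2).
  move=> n; apply: le_trans (XC n); rewrite ler_wpM2l//.
  rewrite sqnormE; last exact: L2B.
  by rewrite ImB lerDr mean_sqr_ge0.
exists (fun w => (g w +i* h w)%C).
  by split.
move=> n; rewrite sqnormE; last by apply: L2B => //; split.
rewrite ReB ImB; apply: le_trans (lerD (gC n) (hC n)) _.
by rewrite le_eqVlt; apply/orP; left; apply/eqP; ring.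
Qed.

(** * Linear spans and closures *)

Lemma sqnormBC X Z : L2 P X -> L2 P Z -> sqnorm (X \- Z) = sqnorm (Z \- X).
Proof.
move=> X2 Z2.
have -> : X \- Z = fun w => X w - 1 * Z w by apply/funext => w /=; ring.
have -> : Z \- X = fun w => Z w - 1 * X w by apply/funext => w /=; ring.
rewrite !sqnorm_sub// (innerC X2 Z2) /sqmod.
by case: (inner P X Z) => x y /=; ring.
Qed.

Lemma closure2_sqnorm M X (e : R) : M `<=` L2 P -> closure2 P M X -> 0 < e ->
  exists2 Z, M Z & sqnorm (X \- Z) < e.
Proof.
move=> M2 [X2 XM] e0; have [|Z MZ] := XM (Num.sqrt e); first by rewrite sqrtr_gt0.
rewrite norm2_lt ?sqrtr_gt0 ?sqr_sqrtr ?(ltW e0)//; first by exists Z.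
by apply: L2B => //; exact: M2.
Qed.

Lemma sqnorm_closure2 M X : M `<=` L2 P -> L2 P X ->
  (forall e : R, 0 < e -> exists2 Z, M Z & sqnorm (X \- Z) < e) ->
  closure2 P M X.
Proof.
move=> M2 X2 XM; split => // e e0; have [|Z MZ XZ] := XM (e ^+ 2).
  exact: exprn_gt0.
by exists Z => //; rewrite norm2_lt//; apply: L2B => //; exact: M2.
Qed.

Lemma subset_closure2 M : M `<=` L2 P -> M `<=` closure2 P M.
Proof.
move=> M2 X MX; have X2 := M2 X MX; apply: sqnorm_closure2 => // e e0.
exists X => //; rewrite (_ : X \- X = fun=> 0).
  by rewrite /sqnorm inner0l//; exact: L2_0.
by apply/funext => w /=; rewrite subrr.
Qed.

Lemma lin_span_L2 G : lin_span P G `<=` L2 P.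
Proof. by move=> X []. Qed.

Lemma closure2_L2 M : closure2 P M `<=` L2 P.
Proof. by move=> X []. Qed.

Lemma lin_spanS G G' : G `<=` G' -> lin_span P G `<=` lin_span P G'.
Proof.
move=> GG' X [X2 [n [c [Z [GZ XZ]]]]]; split => //.
by exists n, c, Z; split => // j; exact/GG'.
Qed.

Lemma subset_lin_span G : G `<=` L2 P -> G `<=` lin_span P G.
Proof.
move=> G2 X GX; split; first exact: G2.
exists 1%N, (fun=> 1), (fun=> X); split => //.
by apply: aeW => w; rewrite big_ord1 mul1r.
Qed.

Lemma lin_span0 G : lin_span P G (fun=> 0).
Proof.
split; first exact: L2_0.
exists 0%N, (fun=> 0), (fun=> fun=> 0); split; first by case.
by apply: aeW => w; rewrite big_ord0.
Qed.

Lemma lin_span_lin G (a : R[i]) X Z : lin_span P G X -> lin_span P G Z ->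
  lin_span P G (fun w => a * X w + Z w).
Proof.
move=> [X2 [n [c [U [GU XU]]]]] [Z2 [m [c' [U' [GU' ZU']]]]].
split; first exact: L2_lin.
exists (n + m)%N, (fun i => match fintype.split i with inl j => a * c j | inr j => c' j end),
  (fun i => match fintype.split i with inl j => U j | inr j => U' j end); split.
  by move=> i; case: (fintype.split i).
apply: filterS2 XU ZU' => w -> ->; rewrite big_split_ord/=; congr (_ + _).
  rewrite mulr_sumr; apply: eq_bigr => i _.
  by rewrite (fintype.unsplitK (inl i)) mulrA.
by apply: eq_bigr => i _; rewrite (fintype.unsplitK (inr i)).
Qed.

Lemma orth_lin_span G X W : G `<=` L2 P -> L2 P W ->
  (forall Z, G Z -> inner P Z W = 0) -> lin_span P G X -> inner P X W = 0.
Proof.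
move=> G2 W2 GW [X2 [n [c [Z [GZ XZ]]]]].
have [S2 SE] := inner_suml c (fun j => G2 _ (GZ j)) W2.
rewrite (eq_ae_innerl X2 S2 W2 XZ) SE big1// => j _.
by rewrite GW// mulr0.
Qed.

(** Cauchy-Schwarz makes the inner product with W continuous. *)
Lemma orth_closure2 M X W : M `<=` L2 P -> L2 P W ->
  (forall Z, M Z -> inner P Z W = 0) -> closure2 P M X -> inner P X W = 0.
Proof.
move=> M2 W2 MW XM; have X2 := closure2_L2 XM.
apply/sqmod_eq0/(le0_of_small (sqnorm_ge0 W2)) => e e0.
have [Z MZ XZ] := closure2_sqnorm M2 XM e0.
rewrite -[inner P X W]subr0 -(MW Z MZ) -innerBl//; last exact: M2.
apply: (le_trans (cauchy_schwarz _ W2)); first by apply: L2B => //; exact: M2.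
by apply: ler_wpM2r; [exact: sqnorm_ge0|exact: ltW].
Qed.

(** * Orthogonal projection and conditional orthogonality *)

(** Existence of the orthogonal projection onto the closure of a subspace M: the
    near-minimisers Z_n of the distance from X to M converge, and X - Z_n is
    orthogonal to M up to a defect that tends to 0. *)
Lemma projection_exists M X :
  M `<=` L2 P -> M (fun=> 0) ->
  (forall (a : R[i]) U V, M U -> M V -> M (fun w => a * U w + V w)) ->
  L2 P X -> exists X', is_proj P (closure2 P M) X X'.
Proof.
move=> M2 M0 Mlin X2.
pose E := [set sqnorm (X \- Z) | Z in M].
have infE : has_inf E.
  split; first by exists (sqnorm (X \- fun=> 0)); exists (fun=> 0).
  by exists 0 => _ [Z MZ <-]; apply: sqnorm_ge0; apply: L2B => //; exact: M2.
have lbE Z : M Z -> inf E <= sqnorm (X \- Z).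
  by move=> MZ; apply: ge_inf; [exact: infE.2|exists Z].
(* The minimum is approached at rate 8^-n, fast enough to beat the weights 4^n
   of [L2_fast_cauchy]. *)
have /choice[Z_ Z_E] n : exists Z, M Z /\ sqnorm (X \- Z) < inf E + 8^-1 ^+ n.
  have [|_ [Z MZ <-] ZE] := @inf_adherent _ E (8^-1 ^+ n) _ infE.
    by rewrite exprn_gt0.
  by exists Z.
have ZM n : M (Z_ n) := (Z_E n).1.
have Z2 n : L2 P (Z_ n) := M2 _ (ZM n).
have XZ2 n : L2 P (X \- Z_ n) := L2B X2 (Z2 n).
have [|Z Zlim2 Zlim] := @L2_fast_cauchy Z_ 8 Z2.
  move=> n; have -> : Z_ n.+1 \- Z_ n = fun w => (X \- Z_ n) w - (X \- Z_ n.+1) w.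
    by apply/funext => w /=; ring.
  rewrite parallelogram//.
  (* The midpoint is X minus the mean of two elements of M, to which the lower
     bound inf E applies. *)
  have -> : (fun w => 2^-1 * (X \- Z_ n) w + 2^-1 * (X \- Z_ n.+1) w) =
     X \- (fun w => 2^-1 * Z_ n w + (2^-1 * Z_ n.+1 w + 0)).
    by apply/funext => w /=; field.
  have := lbE _ (Mlin 2^-1 _ _ (ZM n) (Mlin 2^-1 _ _ (ZM n.+1) M0)).
  set q := sqnorm (X \- fun w => _) => qE.
  have := (Z_E n).2; have := (Z_E n.+1).2.
  rewrite exprS addn1 natrX exprS (_ : 8^-1 ^+ n = (4 ^+ n * 2 ^+ n)^-1 :> R); last first.
    by rewrite -exprMn exprVn; congr (_ ^+ _)^-1; rewrite -natrM.
  have p2 : 0 < (2 : R) ^+ n by rewrite exprn_gt0.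
  have p4 : 0 < (4 : R) ^+ n by rewrite exprn_gt0.
  set e := (_ * _)^-1 => Zn1 Zn; have e0 : 0 < e by rewrite invr_gt0 mulr_gt0.
  have -> : 8 / (2 * 2 ^+ n) = 4 ^+ n * (4 * e).
    by rewrite /e; field; rewrite !gt_eqF.
  by apply: ler_wpM2l; [exact: ltW|lra].
have Zcl : closure2 P M Z.
  apply: sqnorm_closure2 => // e e0.
  have [n ne] := @geometric4_small R (8 * 8) e ltac:(lra) e0.
  by exists (Z_ n) => //; rewrite sqnormBC//; exact: le_lt_trans (Zlim n) ne.
exists Z; split => // V Vcl; have V2 := closure2_L2 Vcl.
have XZlim2 : L2 P (X \- Z) by exact: L2B.
rewrite (innerC V2 XZlim2) (orth_closure2 M2 XZlim2 _ Vcl) ?conjc0//.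
move=> {V2 Vcl} {}V MV; have V2 := M2 _ MV.
rewrite (innerC XZlim2 V2); apply/eqP; rewrite conjc_eq0; apply/eqP.
apply/sqmod_eq0/(le0_of_small (sqnorm_ge0 V2)) => e e0.
(* 130 = 2 (1 + 64): the defect 8^-n <= 4^-n of Z_n and the squared distance
   64 / 4^n from Z_n to Z, each doubled by [sqmodD]. *)
have [n ne] := @geometric4_small R 130 e ltac:(lra) e0.
have -> : inner P (X \- Z) V = inner P (X \- Z_ n) V + inner P (Z_ n \- Z) V.
  by rewrite !innerBl//; ring.
apply: (le_trans (sqmodD _ _)).
have h1 : sqmod (inner P (X \- Z_ n) V) <= 4^-1 ^+ n * sqnorm V.
  apply: near_orthogonal => // c.
  have -> : (fun w => (X \- Z_ n) w - c * V w) = X \- (fun w => c * V w + Z_ n w).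
    by apply/funext => w /=; ring.
  apply: le_trans (lbE _ (Mlin c _ _ MV (ZM n))); rewrite lerBlDr.
  apply: (le_trans (ltW (Z_E n).2)); rewrite lerD2l.
  by apply: lerXn2r; rewrite ?nnegrE; lra.
have h2 : sqmod (inner P (Z_ n \- Z) V) <= 64 * 4^-1 ^+ n * sqnorm V.
  apply: (le_trans (cauchy_schwarz (L2B (Z2 n) Zlim2) V2)).
  apply: ler_wpM2r; first exact: sqnorm_ge0.
  by apply: le_trans (Zlim n) _; rewrite exprVn; lra.
have := sqnorm_ge0 V2; move: ne h1 h2; rewrite -exprVn.
set s := sqnorm V; set p := 4^-1 ^+ n; nra.
Qed.

Section Residual.
Variable G : set (T -> R[i]).
Let L := closure2 P (lin_span P G).
Let res X : T -> R[i] := X \- Defs.proj P L X.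

Lemma is_proj_proj X : L2 P X -> is_proj P L X (Defs.proj P L X).
Proof.
move=> X2; apply: (xgetPex (cst 0)); apply: projection_exists X2.
- exact: lin_span_L2.
- exact: lin_span0.
- by move=> a U V; exact: lin_span_lin.
Qed.

Lemma residual_L2 X : L2 P X -> L2 P (res X).
Proof. by move=> X2; apply: L2B => //; exact: closure2_L2 (is_proj_proj X2).1. Qed.

Lemma residual_orth X Z : L2 P X -> L Z -> inner P Z (res X) = 0.
Proof.
move=> X2 LZ; rewrite (innerC (residual_L2 X2) (closure2_L2 LZ)).
by rewrite (is_proj_proj X2).2// conjc0.
Qed.

(** Only one of the two residuals matters, since the projection of X is
    orthogonal to the residual of Z. *)
Lemma inner_residuals X Z : L2 P X -> L2 P Z ->
  inner P (res X) (res Z) = inner P X (res Z).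
Proof.
move=> X2 Z2; have LX := (is_proj_proj X2).1.
rewrite innerBl ?(residual_orth Z2 LX) ?subr0//.
  exact: closure2_L2 LX.
exact: residual_L2.
Qed.

Lemma cond_orth_mem_l : cond_orth P L (L2 P) L.
Proof.
move=> X Z LX Z2; rewrite -!/(res _) inner_residuals ?residual_orth//.
exact: closure2_L2 LX.
Qed.

Lemma cond_orth_mem_r : cond_orth P (L2 P) L L.
Proof.
move=> X Z X2 LZ; have Z2 := closure2_L2 LZ; rewrite -!/(res _).
by rewrite (innerC (residual_L2 Z2) (residual_L2 X2)) cond_orth_mem_l// conjc0.
Qed.

(** By [inner_residuals] the condition is closed under linear combinations and
    limits in each variable separately, so it extends from generators to closed spans, first in X for
    the given Z, then in Z for a generator X. *)
Lemma cond_orth_closure_span G1 H : G1 `<=` L2 P -> H `<=` L2 P ->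
  cond_orth P G1 H L ->
  cond_orth P (closure2 P (lin_span P G1)) (closure2 P (lin_span P H)) L.
Proof.
move=> G1_2 H_2 G1HL X Z XG ZG; rewrite -!/(res _).
have X2 := closure2_L2 XG; have Z2 := closure2_L2 ZG.
rewrite inner_residuals//.
apply: (orth_closure2 (@lin_span_L2 G1) (residual_L2 Z2) _ XG) => {X2 XG} {}X XG.
apply: (orth_lin_span G1_2 (residual_L2 Z2) _ XG) => {XG} {}X XG.
have X2 := G1_2 _ XG.
rewrite -inner_residuals// (innerC (residual_L2 Z2) (residual_L2 X2)).
rewrite inner_residuals//; apply/eqP; rewrite conjc_eq0; apply/eqP.
apply: (orth_closure2 (@lin_span_L2 H) (residual_L2 X2) _ ZG) => {Z2 ZG} {}Z ZG.
apply: (orth_lin_span H_2 (residual_L2 X2) _ ZG) => {ZG} {}Z ZG.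
have Z2 := H_2 _ ZG.
by rewrite -inner_residuals// (innerC (residual_L2 X2) (residual_L2 Z2)) G1HL// conjc0.
Qed.

End Residual.

Lemma cond_orthS H1 H1' H2 H2' M : H1 `<=` H1' -> H2 `<=` H2' ->
  cond_orth P H1' H2' M -> cond_orth P H1 H2 M.
Proof. by move=> H11 H22 HM X Z /H11 HX /H22 HZ; exact: HM. Qed.

End ComplexHilbert.

(** * Spaces spanned by a process *)

Section Generators.
Context {R : realType} {d : measure_display} {T : measurableType d}.
Variables (P : probability T R) (k : nat) (Y : 'I_k -> R -> T -> R[i]).
Hypothesis Y2 : forall v t, L2 P (Y v t).
Implicit Types (A S : {set 'I_k}) (s t : \bar R).

(** The generating set of [ell A s t]. *)
Definition observations A s t : set (T -> R[i]) :=
  [set X : T -> R[i] | exists a u,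
    [/\ a \in A, (s <= u%:E <= t)%E & X = Y a u]].

Lemma observations_L2 A s t : observations A s t `<=` L2 P.
Proof. by move=> _ [a [u [_ _ ->]]]. Qed.

Lemma observationsS A A' s s' t t' : A \subset A' -> (s' <= s)%E -> (t <= t')%E ->
  observations A s t `<=` observations A' s' t'.
Proof.
move=> AA' ss' tt' _ [a [u [aA /andP[su ut] ->]]]; exists a, u.
by rewrite (fintype.subsetP AA' _ aA) (le_trans ss' su) (le_trans ut tt').
Qed.

Lemma ellS A A' s s' t t' : A \subset A' -> (s' <= s)%E -> (t <= t')%E ->
  ell P Y A s t `<=` ell P Y A' s' t'.
Proof. by move=> *; apply: lin_spanS; exact: observationsS. Qed.

Lemma ell_cell A s t : ell P Y A s t `<=` cell P Y A s t.
Proof. by apply: subset_closure2; exact: lin_span_L2. Qed.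

Lemma observations_cell A s t : observations A s t `<=` cell P Y A s t.
Proof.
by move=> X AX; apply: ell_cell; apply: subset_lin_span AX; exact: observations_L2.
Qed.

Lemma cond_orth_cell A B S s t s' t' (r : R) :
  cond_orth P (observations A s t) (observations B s' t') (past P Y S r) ->
  cond_orth P (cell P Y A s t) (cell P Y B s' t') (past P Y S r).
Proof.
exact (@cond_orth_closure_span _ _ _ P (observations S -oo%E r%:E) _ _
  (@observations_L2 A s t) (@observations_L2 B s' t')).
Qed.

End Generators.

Unset Implicit Arguments.

Theorem lemma4p3 (R : realType) (d : measure_display) (T : measurableType d)
    (P : probability T R) (k : nat) (Y : 'I_k -> R -> T -> R[i])
    (Ystat : weakly_stationary P Y) (Ymean : zero_mean P Y)
    (Ycont : mean_square_continuous P Y)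
    (A B S : {set 'I_k}) (AS : A \subset S) (BS : B \subset S)
    (AB : A :&: B = finset.set0) :
  [<-> (* a *) contemporaneously_uncorrelated P Y A B S;
       (* b *) (forall t : R,
                 cond_orth P (past P Y A (t + 1)) (past P Y B (t + 1))
                             (past P Y S t));
       (* c *) (forall t : R,
                 cond_orth P (ell P Y A t%:E (t + 1)%:E)
                             (ell P Y B t%:E (t + 1)%:E) (past P Y S t));
       (* d *) (forall a b : 'I_k, a \in A -> b \in B ->
                 forall t s s' : R, t <= s <= t + 1 -> t <= s' <= t + 1 ->
                 cond_orth P (ell P Y (finset.set1 a) s%:E s%:E)
                             (ell P Y (finset.set1 b) s'%:E s'%:E)
                             (past P Y S t))].
Proof.
have Y2 : forall v t, L2 P (Y v t) by case: Ystat.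
have o2 C s t := @observations_L2 _ _ _ P _ _ Y2 C s t.
tfae.
- move=> a t; apply: (cond_orth_cell Y2).
  move=> X Z [v [u [vA /andP[_ ut] XE]]] [v' [u' [vB /andP[_ u't] ZE]]].
  (* Observations up to t lie in the conditioning space, since A and B are
     contained in S; when both are later, (a) applies. *)
  have [ut'|tu] := leP u t.
    apply: cond_orth_mem_l; last by rewrite ZE.
    apply: observations_cell => //; exists v, u; split=> //.
      exact: (fintype.subsetP AS).
    by rewrite leNye lee_fin.
  have [u't'|tu'] := leP u' t.
    apply: cond_orth_mem_r; first by rewrite XE.
    apply: observations_cell => //; exists v', u'; split=> //.
      exact: (fintype.subsetP BS).
    by rewrite leNye lee_fin.
  apply: a; apply: observations_cell => //.
    by exists v, u; split=> //; rewrite lee_fin (ltW tu).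
  by exists v', u'; split=> //; rewrite lee_fin (ltW tu').
- move=> b t; apply: cond_orthS (b t) => X XA; apply: ell_cell;
    by apply: ellS XA; rewrite ?leNye.
- move=> c a b aA bB t s s' /andP[ts st] /andP[ts' s't].
  by apply: cond_orthS (c t); apply: ellS; rewrite ?finset.sub1set ?lee_fin.
- move=> d' t; apply: (cond_orth_cell Y2).
  move=> X Z [v [u [vA utt XE]]] [v' [u' [vB u'tt ZE]]].
  apply: (d' v v' vA vB t u u') => //; apply: subset_lin_span; try exact: o2.
    by exists v, u; rewrite finset.set11 !lexx.
  by exists v', u'; rewrite finset.set11 !lexx.
Qed.
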